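(* Suppose that the algebra $A(\xi)$ is such that $\alpha=\beta=1$ and $\nu=0$. Then $A(\xi)$ is semisimple.
   Context: Let $k$ be an algebraically closed field of characteristic $0$, $\Gamma$ a finite abelian group, $\widehat{\Gamma}$ its group of characters $\Gamma\to k^\times$, with trivial character $\epsilon$. Let $g_1,g_2\in\Gamma$ and $\chi_1,\chi_2\in\widehat\Gamma$ with $\chi_1(g_2)\chi_2(g_1)=1$. Let $r>1$ be the order of $q:=\chi_1(g_1)$ and $s>1$ the order of $\chi_2(g_2)$. Let $\alpha_{11},\alpha_{22},\nu\in k$ be scalars such that: $\alpha_{11}=0$ if $g_1^r=1$ or $\chi_1^r\neq\epsilon$; $\alpha_{22}=0$ if $g_2^s=1$ or $\chi_2^s\ne\epsilon$; $\nu=0$ if $g_1g_2=1$ or $\chi_1\chi_2\neq\epsilon$. The lifting $A$ of the quantum plane is the pointed Hopf algebra (of dimension $|\Gamma|rs$) generated by the elements $h\in\Gamma$ (with the relations of the group $\Gamma$) and $x,y$, with relations $hx=\chi_1(h)xh$, $hy=\chi_2(h)yh$ ($h\in\Gamma$), $x^r=\alpha_{11}(g_1^r-1)$, $y^s=\alpha_{22}(g_2^s-1)$, $xy=\chi_2(g_1)yx+\nu(g_1g_2-1)$. Let $\Lambda=\{g\in\Gamma:\chi_1(g)=\chi_2(g)=1\}$, a subgroup of $\Gamma$ that is central in $A$. If $\alpha_{11}\ne0$ then $g_1^r\in\Lambda$, and if $\alpha_{22}\neq 0$ then $g_2^s\in\Lambda$. Fix $\xi\in\widehat\Lambda$ and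 put $\alpha=\alpha_{11}(\xi(g_1^r)-1)$ and $\beta=\alpha_{22}(\xi(g_2^s)-1)$ (understood to be $0$ when $\alpha_{11}=0$, resp. $\alpha_{22}=0$). The algebra $A(\xi)$ is the quotient of $A$ by the relations $g=\xi(g)1$ for $g\in\Lambda$; that is, it is generated by $x$, $y$ and $h\in\Gamma$ with the relations of $\Gamma$ and $g=\xi(g)$ ($g\in\Lambda$), $hx=\chi_1(h)xh$, $hy=\chi_2(h)yh$ ($h\in\Gamma$), $x^r=\alpha$, $y^s=\beta$, $xy=\chi_2(g_1)yx+\nu(g_1g_2-1)$. *)

(* Defs.v *)
From HB Require Import structures.
From mathcomp Require Import all_boot all_order all_algebra all_fingroup.
From mathcomp Require Import ring_quotient boolp.
From mathcomp Require Import monalg.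

Set Implicit Arguments.
Unset Strict Implicit.
Unset Printing Implicit Defensive.

Import GRing.Theory.
Local Open Scope ring_scope.
Local Open Scope quotient_scope.

Section SemisimpleModules.
Variables (R : pzRingType) (V : lmodType R).

Definition simple_submod (W : {pred V}) : Prop :=
  [/\ submod_closed W,
      exists2 v, v \in W & v != 0
    & forall U : {pred V}, submod_closed U -> {subset U <= W} ->
        U =i pred1 0 \/ U =i W].

Definition internal_direct_sum (I : choiceType) (W : I -> {pred V}) : Prop :=
  (forall v : V, exists (t : seq I) (u : I -> V),
      (forall i, u i \in W i) /\ v = \sum_(i <- t) u i) /\
  (forall (t : seq I) (u : I -> V), uniq t -> (forall i, u i \in W i) ->
      \sum_(i <- t) u i = 0 -> {in t, forall i, u i = 0}).

Definition semisimple_module : Prop :=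
  exists (I : choiceType) (W : I -> {pred V}),
    (forall i, simple_submod (W i)) /\ internal_direct_sum W.

End SemisimpleModules.

Definition semisimple_ring (R : pzRingType) : Prop := @semisimple_module R R^o.

Definition free_alg (k : comNzRingType) (I : choiceType) : Type :=
  {malg k[{fmonom I}]}.

HB.instance Definition _ (k : comNzRingType) (I : choiceType) :=
  GRing.Lalgebra.on (free_alg k I).

Definition free_gen (k : comNzRingType) (I : choiceType) (i : I) :
  free_alg k I := << fmu i >>.

Lemma free_alg_scalerAr (k : comNzRingType) (I : choiceType) (c : k)
  (u v : free_alg k I) : c *: (u * v) = u * (c *: v).
Proof.
rewrite /GRing.mul /= (fgmulrwl (msuppZ_le c v)) fgmulr scaler_sumr.
apply: eq_bigr => j _; rewrite scaler_sumr; apply: eq_bigr => i _.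
by apply/malgP => m; rewrite mcoeffZ !mcoeffU mcoeffZ mulrnAr mulrCA.
Qed.

(* The algebra with generators [I] and relations [u = v] for [rel u v].  It is
   only a [pzRingType] with an [lmodType k] structure, since MathComp's
   [algType] excludes the zero ring and a presented algebra may a priori
   vanish. *)
Section PresentedAlgebra.
Variables (k : comNzRingType) (I : choiceType).
Local Notation F := (free_alg k I).
Variable rel : F -> F -> Prop.

Inductive rel_ideal : F -> Prop :=
  | rel_ideal_gen u v : rel u v -> rel_ideal (u - v)
  | rel_ideal0 : rel_ideal 0
  | rel_idealB u v : rel_ideal u -> rel_ideal v -> rel_ideal (u - v)
  | rel_idealMl a u : rel_ideal u -> rel_ideal (a * u)
  | rel_idealMr u a : rel_ideal u -> rel_ideal (u * a).

Definition rel_ideal_pred : {pred F} := fun u => `[< rel_ideal u >].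

Lemma rel_ideal_zmod_closed : zmod_closed rel_ideal_pred.
Proof.
split=> [|u v /asboolP uI /asboolP vI]; apply/asboolP.
  exact: rel_ideal0.
exact: rel_idealB.
Qed.

HB.instance Definition _ :=
  GRing.isZmodClosed.Build F rel_ideal_pred rel_ideal_zmod_closed.

Definition pres_alg : Type := Quotient.quot rel_ideal_pred.

HB.instance Definition _ := GRing.Zmodule.on pres_alg.

Definition pres_pi (u : F) : pres_alg := \pi_(Quotient.quot rel_ideal_pred) u.
Definition pres_repr (a : pres_alg) : F :=
  @generic_quotient.repr _ (Quotient.quot rel_ideal_pred) a.

Lemma pres_reprK : cancel pres_repr pres_pi.
Proof. exact: reprK. Qed.

Lemma pres_piP (u v : F) : pres_pi u = pres_pi v <-> rel_ideal (u - v).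
Proof.
split=> [/eqP|uv].
  by rewrite /pres_pi -Quotient.idealrBE => /asboolP.
by apply/eqP; rewrite /pres_pi -Quotient.idealrBE; apply/asboolP.
Qed.

Lemma pres_reprP (u : F) : rel_ideal (pres_repr (pres_pi u) - u).
Proof. by apply/pres_piP; rewrite pres_reprK. Qed.

Lemma pres_pi_is_zmod_morphism : zmod_morphism pres_pi.
Proof. by move=> u v; rewrite /pres_pi !piE. Qed.

HB.instance Definition _ :=
  GRing.isZmodMorphism.Build F pres_alg pres_pi pres_pi_is_zmod_morphism.

Lemma rel_idealD u v : rel_ideal u -> rel_ideal v -> rel_ideal (u + v).
Proof.
move=> uI vI; rewrite -[v]opprK -[- v]sub0r; apply: rel_idealB => //.
by apply: rel_idealB => //; apply: rel_ideal0.
Qed.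

Definition pres_one : pres_alg := pres_pi 1.
Definition pres_mul (a b : pres_alg) : pres_alg :=
  pres_pi (pres_repr a * pres_repr b).
Definition pres_scale (c : k) (a : pres_alg) : pres_alg :=
  pres_pi (c *: pres_repr a).

Lemma pres_piM u v : pres_pi (u * v) = pres_mul (pres_pi u) (pres_pi v).
Proof.
apply/esym/pres_piP; set u' := pres_repr _; set v' := pres_repr _.
have -> : u' * v' - u * v = (u' - u) * v' + u * (v' - v).
  by rewrite mulrBl mulrBr addrA subrK.
apply: rel_idealD; first exact/rel_idealMr/pres_reprP.
exact/rel_idealMl/pres_reprP.
Qed.

Lemma pres_piZ c u : pres_pi (c *: u) = pres_scale c (pres_pi u).
Proof.
apply/esym/pres_piP; rewrite -scalerBr -[_ - u]mul1r scalerAl.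
exact/rel_idealMl/pres_reprP.
Qed.

Lemma pres_mulA : associative pres_mul.
Proof.
move=> a b c; rewrite -[a]pres_reprK -[b]pres_reprK -[c]pres_reprK.
by rewrite -!pres_piM mulrA.
Qed.

Lemma pres_mul1 : left_id pres_one pres_mul.
Proof. by move=> a; rewrite -[a]pres_reprK -pres_piM mul1r. Qed.

Lemma pres_mulr1 : right_id pres_one pres_mul.
Proof. by move=> a; rewrite -[a]pres_reprK -pres_piM mulr1. Qed.

Lemma pres_mulDl : left_distributive pres_mul +%R.
Proof.
move=> a b c; rewrite -[a]pres_reprK -[b]pres_reprK -[c]pres_reprK.
by rewrite -raddfD -!pres_piM mulrDl raddfD.
Qed.

Lemma pres_mulDr : right_distributive pres_mul +%R.
Proof.
move=> a b c; rewrite -[a]pres_reprK -[b]pres_reprK -[c]pres_reprK.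
by rewrite -raddfD -!pres_piM mulrDr raddfD.
Qed.

HB.instance Definition _ := GRing.Zmodule_isPzRing.Build pres_alg
  pres_mulA pres_mul1 pres_mulr1 pres_mulDl pres_mulDr.

Lemma pres_pi_is_monoid_morphism : monoid_morphism pres_pi.
Proof. by split=> // u v; apply: pres_piM. Qed.

HB.instance Definition _ :=
  GRing.isMonoidMorphism.Build F pres_alg pres_pi pres_pi_is_monoid_morphism.

Lemma pres_scaleA c d a :
  pres_scale c (pres_scale d a) = pres_scale (c * d) a.
Proof. by rewrite -[a]pres_reprK -!pres_piZ scalerA. Qed.

Lemma pres_scale1 : left_id 1 pres_scale.
Proof. by move=> a; rewrite -[a]pres_reprK -pres_piZ scale1r. Qed.

Lemma pres_scaleDr : right_distributive pres_scale +%R.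
Proof.
move=> c a b; rewrite -[a]pres_reprK -[b]pres_reprK.
by rewrite -raddfD -!pres_piZ scalerDr raddfD.
Qed.

Lemma pres_scaleDl a : {morph pres_scale^~ a : c d / c + d}.
Proof.
move=> c d; rewrite -[a]pres_reprK -!pres_piZ.
by rewrite scalerDl raddfD.
Qed.

HB.instance Definition _ := GRing.Zmodule_isLmodule.Build k pres_alg
  pres_scaleA pres_scale1 pres_scaleDr pres_scaleDl.

Lemma pres_pi_is_scalable : scalable pres_pi.
Proof. by move=> c u; apply: pres_piZ. Qed.

Lemma pres_scalerAl (c : k) (a b : pres_alg) : c *: (a * b) = (c *: a) * b.
Proof.
rewrite -[a]pres_reprK -[b]pres_reprK -rmorphM -!pres_pi_is_scalable -rmorphM.
by rewrite scalerAl.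
Qed.

Lemma pres_scalerAr (c : k) (a b : pres_alg) : c *: (a * b) = a * (c *: b).
Proof.
rewrite -[a]pres_reprK -[b]pres_reprK -rmorphM -!pres_pi_is_scalable -rmorphM.
by rewrite free_alg_scalerAr.
Qed.

End PresentedAlgebra.

(* Nonvanishing on [D] is automatic when [D] is a group. *)
Definition is_character (k : fieldType) (gT : finGroupType) (D : {set gT})
    (chi : gT -> k) : Prop :=
  chi 1%g = 1 /\ {in D &, forall g h, chi (g * h)%g = chi g * chi h}.

Section LiftingQuantumPlane.
Variables (k : fieldType) (gT : finGroupType).
Variables (g1 g2 : gT) (chi1 chi2 : gT -> k) (r s : nat).
Variables (alpha11 alpha22 nu : k).

Definition lifting_gen : Type := (gT + bool)%type.
HB.instance Definition _ := Finite.on lifting_gen.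

Local Notation F := (free_alg k lifting_gen).

Definition gen_grp (h : gT) : F := free_gen k (inl h : lifting_gen).
Definition gen_x : F := free_gen k (inr false : lifting_gen).
Definition gen_y : F := free_gen k (inr true : lifting_gen).

Inductive lifting_rel : F -> F -> Prop :=
  | lifting_grp1 : lifting_rel (gen_grp 1%g) 1
  | lifting_grpM g h :
      lifting_rel (gen_grp g * gen_grp h) (gen_grp (g * h)%g)
  | lifting_hx h :
      lifting_rel (gen_grp h * gen_x) (chi1 h *: (gen_x * gen_grp h))
  | lifting_hy h :
      lifting_rel (gen_grp h * gen_y) (chi2 h *: (gen_y * gen_grp h))
  | lifting_xr :
      lifting_rel (gen_x ^+ r) (alpha11 *: (gen_grp (g1 ^+ r)%g - 1))
  | lifting_ys :
      lifting_rel (gen_y ^+ s) (alpha22 *: (gen_grp (g2 ^+ s)%g - 1))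
  | lifting_xy :
      lifting_rel (gen_x * gen_y)
        (chi2 g1 *: (gen_y * gen_x) + nu *: (gen_grp (g1 * g2)%g - 1)).

Definition lifting : Type := pres_alg lifting_rel.
HB.instance Definition _ := GRing.PzRing.on lifting.
HB.instance Definition _ := GRing.Lmodule.on lifting.

Definition Lambda : {set gT} := [set g | (chi1 g == 1) && (chi2 g == 1)].

Variable xi : gT -> k.

Inductive lifting_quot_rel : F -> F -> Prop :=
  | lifting_quot_lift u v : lifting_rel u v -> lifting_quot_rel u v
  | lifting_quot_Lambda g :
      g \in Lambda -> lifting_quot_rel (gen_grp g) (xi g *: 1).

(* The algebra [A(xi)], quotient of [A] (that is, [lifting]) by [g = xi g] for
   [g] in [Lambda]: both families of relations are imposed at once on the free
   algebra. *)
Definition lifting_quot : Type := pres_alg lifting_quot_rel.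
HB.instance Definition _ := GRing.PzRing.on lifting_quot.
HB.instance Definition _ := GRing.Lmodule.on lifting_quot.

(* If [alpha11 != 0] then [g1 ^+ r] lies in [Lambda], so the values of [xi]
   outside [Lambda] are irrelevant; likewise for [g2 ^+ s]. *)
Definition lifting_alpha : k := alpha11 * (xi (g1 ^+ r)%g - 1).
Definition lifting_beta : k := alpha22 * (xi (g2 ^+ s)%g - 1).

End LiftingQuantumPlane.

(* Main.v *)
(* In [A(xi)] the elements [x] and [y] are invertible, since [x^r = y^s = 1],
   and the monomials [x^i y^j h] multiply, up to nonzero scalars, like the
   elements of the finite group [Z_r x Z_s x Gamma]; they span [A(xi)].
   Averaging a linear projection over these units, as in Maschke's theorem, is
   insensitive to the scalars and shows that every left ideal has a complement,
   so that simple left ideals can be split off by induction on the dimension.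
   The linear independence of the monomials plays no role. *)

Require Import Defs.
From HB Require Import structures.
From mathcomp Require Import all_boot all_order all_algebra all_fingroup.
From mathcomp Require Import boolp monalg.
Import GRing.Theory.
Local Open Scope ring_scope.

Set Implicit Arguments.
Unset Strict Implicit.
Unset Printing Implicit Defensive.

(** * Finite dimensionality from a finite spanning family *)

(** Redundant vectors are discarded by induction on [n]; once none is redundant the family is a
    basis, and its coordinates provide the isomorphism with row vectors. *)
Lemma finite_span_vector (k : fieldType) (V : lmodType k) (n : nat)
    (f : 'I_n -> V) :
    (forall v, exists a : 'I_n -> k, v = \sum_i a i *: f i) ->
  exists m, inhabited (Vector.axiom m V).
Proof.
elim: n f => [|n IH] f fspan.
  exists 0%N; constructor; exists (fun=> 0).
    by move=> c u v; rewrite scaler0 addr0.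
  exists (fun=> 0) => [v|v]; last by rewrite [v]thinmx0.
  by have [a ->] := fspan v; rewrite big_ord0.
case: (pselect (exists i0 (b : 'I_n -> k),
    f i0 = \sum_i b i *: f (lift i0 i))) => [[i0 [b fi0]]|free].
  apply: (IH (fun i => f (lift i0 i))) => v.
  have [a ->] := fspan v; exists (fun i => a i0 * b i + a (lift i0 i)).
  rewrite (bigD1_ord i0) //= fi0 scaler_sumr -big_split /=.
  by apply: eq_bigr => i _; rewrite scalerDl scalerA.
exists n.+1; constructor.
pose e (a : 'rV[k]_n.+1) := \sum_i a 0 i *: f i.
have eP c a b : e (c *: a + b) = c *: e a + e b.
  rewrite scaler_sumr -big_split; apply: eq_bigr => i _ /=.
  by rewrite !mxE scalerDl scalerA.
(* A nonzero coordinate [a 0 i0] could be divided out, expressing [f i0] through the other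
   vectors. *)
have e_inj a : e a = 0 -> a = 0.
  move=> ea0; apply/rowP => i0; rewrite mxE; apply/eqP/negPn/negP => ai0.
  apply: free; exists i0, (fun i => - (a 0 i0)^-1 * a 0 (lift i0 i)).
  move/eqP: ea0; rewrite /e (bigD1_ord i0) //= addr_eq0 => /eqP ea0.
  rewrite -[LHS](scalerK ai0) ea0 scalerN scaler_sumr -sumrN.
  by apply: eq_bigr => i _; rewrite scalerA mulNr scaleNr.
have /choice[g gP] v : exists a, e a = v.
  have [a ->] := fspan v; exists (\row_i a i).
  by apply: eq_bigr => i _; rewrite mxE.
have gK a : g (e a) = a.
  apply/eqP; rewrite -subr_eq0; apply/eqP/e_inj.
  by rewrite addrC -scaleN1r eP gP scaleN1r addNr.
by exists g; [move=> c u v; rewrite -[u]gP -[v]gP -eP !gK | exists e].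
Qed.

(** * Maschke's theorem for projective representations of a finite group *)

Section ProjectiveMaschke.
Variables (k : fieldType) (V : vectType k) (gI : finGroupType).
Variable L : gI -> 'End(V).
Hypothesis card_neq0 : #|gI|%:R != 0 :> k.
Hypothesis L1 : L 1%g = \1%VF.
Hypothesis LM : forall g h,
  exists2 c, c != 0 & (L g \o L h)%VF = c *: L (g * h)%g.

Definition proj_stable (U : {vspace V}) := forall g, (L g @: U <= U)%VS.

Lemma proj_rep_ker0 g : lker (L g) == 0%VS.
Proof.
have [c c0 Lc] := LM g^-1 g; rewrite mulVg L1 in Lc.
apply/lker0P => u v uv; apply: (scalerI c0).
move/lfunP: Lc => Lc; move: (Lc u) (Lc v).
by rewrite !lfunE /= !lfunE uv => <-.
Qed.

(** [L g] is injective, so by dimension it maps [U] onto [U], not merely into it. *)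
Lemma proj_stable_inv U g : proj_stable U -> ((L g)^-1 @: U <= U)%VS.
Proof.
move=> stU; rewrite -(limg_ker0 _ _ (proj_rep_ker0 g)) -limg_comp.
rewrite lker0_compfV ?proj_rep_ker0 // lim1g.
suff /eqP->: (L g @: U)%VS == U by [].
by rewrite eqEdim stU limg_dim_eq ?(eqP (proj_rep_ker0 g)) ?capv0 //=.
Qed.

Lemma proj_Maschke U : proj_stable U ->
  exists W, [/\ proj_stable W, (U + W = fullv)%VS & (U :&: W = 0)%VS].
Proof.
move=> stU; set N : k := #|gI|%:R.
(* The average of the conjugates of a projection onto [U]. Each conjugate is unchanged when [L g] is
   rescaled, so [q] commutes with every [L h], and its kernel is the stable complement. *)
pose q := N^-1 *: \sum_g ((L g)^-1 \o (projv U \o L g))%VF.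
have qE v : q v = N^-1 *: \sum_g (L g)^-1%VF (projv U (L g v)).
  rewrite scale_lfunE sum_lfunE; congr (_ *: _).
  by apply: eq_bigr => g _; rewrite !lfunE /= lfunE.
have qU v : q v \in U.
  rewrite qE memvZ ?memv_suml // => g _.
  by apply: (subvP (proj_stable_inv g stU)); rewrite memv_img ?memv_proj.
have q_id u : u \in U -> q u = u.
  move=> uU; rewrite qE (eq_bigr (fun=> u)) => [|g _].
    by rewrite sumr_const -scaler_nat scalerA mulVf // scale1r.
  by rewrite projv_id ?lker0_lfunK ?proj_rep_ker0 // (subvP (stU g)) ?memv_img.
have qL h v : q (L h v) = L h (q v).
  rewrite !qE linearZ /=; congr (_ *: _).
  (* With [g * h] as the new index on the right, the summands agree one by one: after applying the
     injective [L g], both carry the same scalar [c]. *)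
  rewrite linear_sum /= [RHS](reindex_inj (mulIg h)) /=.
  apply: eq_bigr => g _; have [c c0 /lfunP LMc] := LM g h.
  have {}LMc w : L g (L h w) = c *: L (g * h)%g w.
    by have := LMc w; rewrite comp_lfunE scale_lfunE.
  have /lker0P injg := proj_rep_ker0 g; apply: injg; rewrite !LMc linearZ /=.
  by rewrite !lker0_lfunVK ?proj_rep_ker0 // linearZ.
exists (lker q); split.
- move=> g; apply/subvP => _ /memv_imgP[v + ->]; rewrite !memv_ker qL.
  by move/eqP->; rewrite linear0.
- apply/eqP; rewrite eqEsubv subvf; apply/subvP => v _.
  rewrite -[v](subrK (q v)) addrC memv_add // memv_ker linearB /=.
  by rewrite (q_id (q v)) ?subrr.
- apply/eqP; rewrite -subv0; apply/subvP => v; rewrite memv_cap memv0 memv_ker.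
  by case/andP => vU; rewrite q_id.
Qed.

Definition proj_simple (U : {vspace V}) :=
  [/\ proj_stable U, U != 0%VS
    & forall W, proj_stable W -> (W <= U)%VS -> W = 0%VS \/ W = U].

Lemma proj_stable_cap U W :
  proj_stable U -> proj_stable W -> proj_stable (U :&: W).
Proof.
move=> stU stW g; apply/subvP => _ /memv_imgP[v /memv_capP[vU vW] ->].
by rewrite memv_cap (subvP (stU g)) ?(subvP (stW g)) ?memv_img.
Qed.

(** Descent on the dimension: a stable subspace that is not simple contains a smaller nonzero
    one. *)
Lemma proj_simple_sub U : proj_stable U -> U != 0%VS ->
  exists2 S, proj_simple S & (S <= U)%VS.
Proof.
have [n] := ubnP (\dim U); elim: n => // n IH in U * => leUn stU U0.
case: (pselect (proj_simple U)) => [sU|nsU]; first by exists U.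
have [W [stW sWU W0 WU]] : exists W,
    [/\ proj_stable W, (W <= U)%VS, W != 0%VS & W != U].
  apply/notP => noW; apply: nsU; split=> // W stW sWU.
  have [->|W0] := eqVneq W 0%VS; first by left.
  by have [->|WU] := eqVneq W U; [right | case: noW; exists W].
have ltWn : (\dim W < n)%N.
  rewrite ltnS in leUn; apply: leq_trans leUn; rewrite ltnNge.
  apply/negP => dimUW.
  by case/negP: WU; rewrite eqEdim sWU.
have [S sS sSW] := IH W ltWn stW W0.
by exists S => //; apply: subv_trans sWU.
Qed.

(** A simple subspace is split off and induction applies to a complement inside [U]. The equality of
    dimensions records that the sum is direct. *)
Lemma proj_semisimple U : proj_stable U ->
  exists2 s : seq {vspace V}, (forall S, S \in s -> proj_simple S) &
    (\sum_(S <- s) S)%VS = U /\ (\sum_(S <- s) \dim S)%N = \dim U.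
Proof.
have [n] := ubnP (\dim U); elim: n => // n IH in U * => leUn stU.
have [->|U0] := eqVneq U 0%VS; first by exists [::]; rewrite ?big_nil ?dimv0.
have [S sS sSU] := proj_simple_sub stU U0; have [stS S0 _] := sS.
have [W [stW SW_T SW0]] := proj_Maschke stS.
(* The modular law: [W] complements [S] in the whole space, and [S] lies in [U]. *)
have SUW : (S + (U :&: W) = U)%VS.
  apply/eqP; rewrite eqEsubv subv_add sSU capvSl; apply/subvP => u uU.
  have := memvf u; rewrite -SW_T => /memv_addP[v vS [w wW uE]].
  rewrite uE memv_add // memv_cap wW -[w](addKr v) -uE addrC rpredB //.
  exact: (subvP sSU).
have dimUW : (\dim S + \dim (U :&: W) = \dim U)%N.
  rewrite -{2}SUW dimv_disjoint_sum //; apply/eqP; rewrite -subv0 -SW0.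
  by rewrite capvS ?capvSr.
have ltUWn : (\dim (U :&: W) < n)%N.
  rewrite ltnS in leUn; apply: leq_trans leUn.
  by rewrite -dimUW -add1n leq_add2r lt0n dimv_eq0.
have [s sP [sumS dimS]] := IH _ ltUWn (proj_stable_cap stU stW).
exists (S :: s) => [T|]; last by rewrite !big_cons sumS dimS.
by rewrite inE => /predU1P[->|/sP].
Qed.

End ProjectiveMaschke.

(** Among the [{vspace V}] contained in [W], one of maximal dimension must be all of [W], as
    adjoining a missing vector would enlarge it. *)
Lemma subspace_vspace (k : fieldType) (V : vectType k) (W : {pred V}) :
  submod_closed W -> exists U : {vspace V}, U =i W.
Proof.
move=> [W0 Wlin].
pose P n := `[< exists2 U : {vspace V}, {subset U <= W} & \dim U = n >].
have exP : exists n, P n.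
  exists 0%N; apply/asboolP; exists 0%VS; rewrite ?dimv0 // => v.
  by rewrite memv0 => /eqP->.
have leP n : P n -> (n <= dim V)%N.
  by move=> /asboolP[U _ <-]; rewrite -dimvf dimvS ?subvf.
case: (ex_maxnP exP leP) => _ /asboolP[U sUW <-] maxU.
exists U => v; apply/idP/idP => [/sUW//|vW].
suff /eqP-> : U == (U + <[v]>)%VS by rewrite (subvP (addvSr U _)) ?memv_line.
rewrite eqEdim addvSl maxU //; apply/asboolP; exists (U + <[v]>)%VS => //.
move=> _ /memv_addP[w /sUW wW [_ /vlineP[c ->] ->]].
by rewrite addrC Wlin.
Qed.

(** * Rings spanned over central scalars by a projective image of a finite group *)

Section CentralScalars.
Variables (k : fieldType) (R : pzRingType) (iota : {rmorphism k -> R}).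

(* [iota] is kept in the type so that the scalar action can be inferred. *)
Definition central_mod : Type := let _ := iota in R.
HB.instance Definition _ := GRing.Zmodule.on central_mod.

Definition central_scale (c : k) (v : central_mod) : central_mod := iota c * v.

Lemma central_scaleA c d v :
  central_scale c (central_scale d v) = central_scale (c * d) v.
Proof. by rewrite /central_scale rmorphM mulrA. Qed.

Lemma central_scale1 : left_id 1 central_scale.
Proof. by move=> v; rewrite /central_scale rmorph1 mul1r. Qed.

Lemma central_scaleDr : right_distributive central_scale +%R.
Proof. by move=> c u v; rewrite /central_scale mulrDr. Qed.

Lemma central_scaleDl v : {morph central_scale^~ v : c d / c + d}.
Proof. by move=> c d; rewrite /central_scale rmorphD mulrDl. Qed.

HB.instance Definition _ := GRing.Zmodule_isLmodule.Build k central_mod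
  central_scaleA central_scale1 central_scaleDr central_scaleDl.

Variables (gI : finGroupType) (u : gI -> R).
Hypothesis iotaC : forall c a, iota c * a = a * iota c.
Hypothesis card_neq0 : #|gI|%:R != 0 :> k.
Hypothesis u1 : u 1%g = 1.
Hypothesis uM : forall g h,
  exists2 c, c != 0 & u g * u h = iota c * u (g * h)%g.
Hypothesis u_span : forall a, exists c : gI -> k, a = \sum_g iota (c g) * u g.

(** Left multiplications by the [u g] form a projective representation on [R]. Since the [u g] span
    [R], its stable subspaces are exactly the left ideals, so its decomposition is one of the
    regular module. *)
Lemma projective_span_semisimple : semisimple_ring R.
Proof.
have [m [axV]] : exists m, inhabited (Vector.axiom m central_mod).
  pose f (i : 'I_#|gI|) : central_mod := u (enum_val i).
  apply: (finite_span_vector (f := f)) => v.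
  have [c ->] := u_span v; exists (fun i => c (enum_val i)).
  by rewrite (reindex_onto enum_val enum_rank) => [|g _];
    [apply: eq_bigl => i; rewrite enum_valK eqxx | rewrite enum_rankK].
pose V : vectType k :=
  HB.pack central_mod (Lmodule_hasFinDim.Build k central_mod axV).
have VZ (c : k) (v : V) : c *: v = (iota c * (v : R) : R) by [].
pose l g (v : V) : V := u g * (v : R).
have l_lin g : linear (l g).
  by move=> c v w; rewrite /l VZ (mulrDr (u g)) VZ mulrA -iotaC mulrA.
pose lL g : {linear V -> V} :=
  HB.pack (l g) (GRing.isLinear.Build k V V *:%R (l g) (l_lin g)).
pose L g : 'End(V) := linfun (lL g).
have LE g (v : V) : L g v = u g * (v : R) by rewrite lfunE.
have L1 : L 1%g = \1%VF.
  by apply/lfunP => v; rewrite LE id_lfunE u1 mul1r.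
have LM g h : exists2 c, c != 0 & (L g \o L h)%VF = c *: L (g * h)%g.
  have [c c0 uE] := uM g h; exists c => //; apply/lfunP => v.
  by rewrite scale_lfunE comp_lfunE !LE VZ !mulrA uE.
pose P (U : {vspace V}) : {pred R^o} := mem U.
have stP (U : {vspace V}) : proj_stable L U <-> submod_closed (P U).
  split=> [stU|[_ linU] g].
    split=> [|a v w vU wU]; first exact: mem0v.
    have [c aE] := u_span a.
    have -> : a *: v + w = (\sum_g c g *: L g v) + w :> V.
      congr (_ + _); rewrite [LHS](congr1 ( *%R^~ v) aE) mulr_suml.
      by apply: eq_bigr => g _; rewrite VZ LE mulrA.
    have vU' : (v : V) \in U := vU.
    rewrite [_ \in _]memvD // memv_suml // => g _.
    by rewrite memvZ // (subvP (stU g)) ?memv_img.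
  apply/subvP => _ /memv_imgP[v vU ->].
  by have := linU (u g) v 0 vU (mem0v U); rewrite addr0 LE.
have subP (W : {pred R^o}) : submod_closed W ->
    exists2 U : {vspace V}, proj_stable L U & U =i W.
  move=> clW; have [W0 linW] := clW.
  have [|U UW] := @subspace_vspace k V W.
    by split=> // c v w vW wW; rewrite VZ linW.
  have UE v : (v \in P U) = (v \in W) := UW v.
  exists U => //; apply/stP; split=> [|a v w]; first by rewrite UE.
  by rewrite !UE; apply: linW.
have stT : proj_stable L fullv by move=> g; apply: subvf.
have [s sP [sumS dimS]] := proj_semisimple card_neq0 L1 LM stT.
pose W (i : 'I_(size s)) : {vspace V} := nth 0%VS s i.
have simW i : proj_simple L (W i) by apply/sP/mem_nth.
have sumW : (\sum_i W i)%VS = fullv.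
  by rewrite -sumS (big_nth 0%VS) big_mkord.
(* The dimensions of the summands add up to that of the whole space. *)
have dirW : directv (\sum_i W i).
  by rewrite directvE /= sumW -dimS (big_nth 0%VS) big_mkord.
exists 'I_(size s), (fun i => P (W i)); split=> [i|].
  have [stW W0 minW] := simW i; split; first exact/stP.
    exists (vpick (W i)); first exact: memv_pick.
    by rewrite -[_ == _]/(vpick (W i) == 0 :> V) vpick0.
  move=> U clU sUW; have [X stX XU] := subP U clU.
  have [] := minW X stX; first by apply/subvP => v /[!XU]/sUW.
    move=> XU0; left=> v; rewrite -XU XU0; exact: memv0.
  by move=> XU0; right=> v; rewrite -XU XU0.
split=> [v|t v ut vW v0 i it].
  have := memvf (v : V); rewrite -sumW => /memv_sumP[w wW ->].
  by exists (index_enum 'I_(size s)), w; split=> // i; apply: wW.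
(* Independence is available for families over all indices, so [v] is extended by zero outside
   [t]. *)
have /directv_sum_independent/(_ (fun i => if i \in t then v i else 0)) := dirW.
move=> /(_ _ _ i isT); rewrite it; apply=> [j _|].
  by case: ifP => _; [apply: vW | apply: mem0v].
by rewrite -big_mkcond -big_uniq.
Qed.
End CentralScalars.

(** * Monomials in elements commuting up to scalars *)

(** Each of the [m * n] exchanges of an [a] with a [b] contributes one central factor [z]. *)
Lemma skew_commX (R : pzRingType) (z a b : R) m n :
    (forall c, GRing.comm z c) -> a * b = z * (b * a) ->
  a ^+ m * b ^+ n = z ^+ (m * n) * (b ^+ n * a ^+ m).
Proof.
move=> zC ab.
have zX c l : c * z ^+ l = z ^+ l * c := commrX l (commr_sym (zC c)).
have abn : a * b ^+ n = z ^+ n * (b ^+ n * a).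
  elim: n => [|n IH]; first by rewrite !expr0 mulr1 !mul1r.
  rewrite exprS mulrA ab -!mulrA IH [b * _]mulrA zX !mulrA -exprS.
  by rewrite -!mulrA !exprS !mulrA.
elim: m => [|m IH]; first by rewrite mul0n !expr0 mulr1 !mul1r.
rewrite exprS -mulrA IH mulrA zX -mulrA [a * _]mulrA abn mulrA mulSn.
by rewrite addnC exprD !mulrA.
Qed.

Section SkewMonomials.
Variables (k : fieldType) (R : pzRingType) (iota : {rmorphism k -> R}).
Variables (gT : finGroupType) (r s : nat) (x y : R) (e : gT -> R).
Variables (chi1 chi2 : gT -> k) (q : k).
Hypothesis iotaC : forall c a, iota c * a = a * iota c.
Hypotheses (r_gt1 : (1 < r)%N) (s_gt1 : (1 < s)%N).
Hypotheses (xr : x ^+ r = 1) (ys : y ^+ s = 1).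
Hypothesis eM : forall g h, e (g * h)%g = e g * e h.
Hypothesis ex : forall g, e g * x = iota (chi1 g) * (x * e g).
Hypothesis ey : forall g, e g * y = iota (chi2 g) * (y * e g).
Hypothesis yx : y * x = iota q * (x * y).

(** Taking exponents in ['Z_r] and ['Z_s] makes the index set a finite group, to which the averaging
    argument applies. *)
Definition skew_monomial (p : 'Z_r * 'Z_s * gT) : R :=
  x ^+ p.1.1 * y ^+ p.1.2 * e p.2.

Lemma skew_monomialM (p p' : 'Z_r * 'Z_s * gT) :
  skew_monomial p * skew_monomial p' =
  iota (q ^+ (p.1.2 * p'.1.1) * chi1 p.2 ^+ p'.1.1 * chi2 p.2 ^+ p'.1.2) *
    skew_monomial (p * p')%g.
Proof.
case: p p' => [[i j] g] [[i' j'] h]; rewrite /skew_monomial /= eM.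
(* Addition in ['Z_r] reduces modulo [(Zp_trunc r).+2], which equals [r] because [1 < r]; the
   reduction is harmless since [x ^+ r = 1]. *)
have modr m : x ^+ (m %% (Zp_trunc r).+2) = x ^+ m.
  by rewrite Zp_cast // expr_mod.
have mods m : y ^+ (m %% (Zp_trunc s).+2) = y ^+ m.
  by rewrite Zp_cast // expr_mod.
have -> : x ^+ (i * i')%g = x ^+ i * x ^+ i'.
  by rewrite -exprD -[RHS]modr.
have -> : y ^+ (j * j')%g = y ^+ j * y ^+ j'.
  by rewrite -exprD -[RHS]mods.
have iC c : forall a, GRing.comm (iota c) a by move=> a; apply: iotaC.
have gx := skew_commX 1 i' (iC _) (ex g); rewrite !expr1 mul1n -rmorphXn in gx.
have gy := skew_commX 1 j' (iC _) (ey g); rewrite !expr1 mul1n -rmorphXn in gy.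
have yxX := skew_commX j i' (iC _) yx; rewrite -rmorphXn in yxX.
have sw c a b : a * (iota c * b) = iota c * (a * b) by rewrite mulrA -iC mulrA.
(* Sorting: [e g] moves right past both powers, then [y ^+ j] past [x ^+ i']; these moves yield the
   three factors of the scalar. *)
have -> : x ^+ i * y ^+ j * e g * (x ^+ i' * y ^+ j' * e h) =
  x ^+ i * (y ^+ j * ((e g * x ^+ i') * y ^+ j')) * e h by rewrite !mulrA.
rewrite gx -[iota _ * _ * _]mulrA sw -[_ * e g * _]mulrA gy.
rewrite [_ ^+ i' * _]sw [_ ^+ j * (iota _ * _)]sw [_ ^+ j * _]mulrA yxX.
rewrite -[iota (q ^+ _) * _ * _]mulrA [iota (chi2 _ ^+ _) * _]mulrA
  [iota (chi1 _ ^+ _) * _]mulrA -!rmorphM sw -mulrA.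
by congr (iota _ * _); [rewrite mulrA mulrC mulrA | rewrite !mulrA].
Qed.

Hypothesis e1 : e 1%g = 1.

Lemma skew_monomial1 : skew_monomial 1%g = 1.
Proof. by rewrite /skew_monomial /= !expr0 !mul1r. Qed.

Lemma skew_monomial_grp h : skew_monomial (0, 0, h) = e h.
Proof. by rewrite /skew_monomial /= !expr0 !mul1r. Qed.

Lemma skew_monomial_x : skew_monomial (1, 0, 1%g) = x.
Proof.
by rewrite /skew_monomial /= expr0 !mulr1 e1 mulr1 Zp_cast // modn_small ?expr1.
Qed.

Lemma skew_monomial_y : skew_monomial (0, 1, 1%g) = y.
Proof.
by rewrite /skew_monomial /= expr0 mul1r e1 mulr1 Zp_cast // modn_small ?expr1.
Qed.

End SkewMonomials.

(** * Semisimplicity of presented algebras *)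

Section PresentedProjective.
Variables (k : fieldType) (I : choiceType).
Variable rel : free_alg k I -> free_alg k I -> Prop.
Local Notation A := (pres_alg rel).
Local Notation pi := (@pres_pi k I rel).
Implicit Types (a b : A) (c : k).

Lemma pres_pi_rel u v : rel u v -> pi u = pi v.
Proof. by move=> uv; apply/pres_piP/rel_ideal_gen. Qed.

Definition pres_const c : A := c *: (1 : A).

Lemma pres_constE c a : pres_const c * a = c *: a.
Proof. by rewrite /pres_const -pres_scalerAl mul1r. Qed.

Lemma pres_constC c a : pres_const c * a = a * pres_const c.
Proof. by rewrite pres_constE -pres_scalerAr mulr1. Qed.

Lemma pres_const_is_zmod_morphism : zmod_morphism pres_const.
Proof. by move=> c d; apply: scalerBl. Qed.

Lemma pres_const_is_monoid_morphism : monoid_morphism pres_const.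
Proof.
by split=> [|c d]; rewrite /pres_const ?scale1r // -scalerA -pres_constE.
Qed.

HB.instance Definition _ :=
  GRing.isZmodMorphism.Build k A pres_const pres_const_is_zmod_morphism.
HB.instance Definition _ :=
  GRing.isMonoidMorphism.Build k A pres_const pres_const_is_monoid_morphism.

(** The generators are among the [u g], whose products are again scalar multiples of some [u g].
    Hence so is every word in the generators, and the [u g] span. *)
Lemma pres_projective_semisimple (gI : finGroupType) (u : gI -> A) :
    #|gI|%:R != 0 :> k -> u 1%g = 1 ->
    (forall g h, exists2 c, c != 0 & u g * u h = pres_const c * u (g * h)%g) ->
    (forall i, exists g, pi (free_gen k i) = u g) ->
  semisimple_ring A.
Proof.
move=> cardG u1 uM gen_u.
apply: (@projective_span_semisimple _ _ pres_const _ u pres_constC cardG u1 uM).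
have word (w : {fmonom I}) : exists c g, pi << w >> = c *: u g.
  case: w => w; elim: w => [|i w [c [g IH]]].
    by exists 1, 1%g; rewrite scale1r u1 -(rmorph1 pi); congr (pi << _ >>);
       apply/val_inj; rewrite /= fm1.
  have -> :
    << FMonom (i :: w) >> = free_gen k i * << FMonom w >> :> free_alg k I.
    rewrite [RHS]fgmulUU mulr1; congr << _ >>.
    by apply/val_inj; rewrite /= fmM fmU.
  have [h hE] := gen_u i; have [d d0 uhg] := uM h g.
  have -> : pi (free_gen k i * << FMonom w >>) = u h * (c *: u g).
    by etransitivity; [exact: (rmorphM pi) | congr (_ * _)].
  exists (c * d), (h * g)%g; rewrite -[LHS]pres_scalerAr uhg pres_constE.
  exact: scalerA.
move=> a; rewrite -[a]pres_reprK [pres_repr a]monalgE raddf_sum.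
elim/big_rec: _ => [|w b _ [c ->]].
  by exists (fun=> 0); rewrite big1 // => g _; rewrite rmorph0 mul0r.
have [d [g wE]] := word w.
(* The word [w] maps to [d *: u g], so only the coefficient at [g] changes. *)
exists (fun h => c h + if h == g then (pres_repr a)@_w * d else 0).
under [RHS]eq_bigr do rewrite rmorphD mulrDl.
rewrite big_split addrC; congr (_ + _) => /=.
rewrite (bigD1 g) //= eqxx big1 ?addr0 => [|h /negPf->]; last first.
  by rewrite rmorph0 mul0r.
rewrite pres_constE -scalerA -wE -[RHS]pres_pi_is_scalable; congr pi.
by apply/malgP => w'; rewrite mcoeffZ [LHS]mcoeffU mcoeffU mulrnAr mulr1.
Qed.
End PresentedProjective.

(** * Character values and the application to [lifting_quot] *)

Lemma character_neq0 (k : fieldType) (gT : finGroupType) (chi : gT -> k) g :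
  is_character [set: gT] chi -> chi g != 0.
Proof.
move=> [chi1 chiM]; apply/eqP => chig0.
have := oner_neq0 k; rewrite -chi1 -(mulgV g) chiM ?inE // chig0 mul0r.
by rewrite eqxx.
Qed.

Lemma characterX (k : fieldType) (gT : finGroupType) (chi : gT -> k) g n :
  is_character [set: gT] chi -> chi (g ^+ n)%g = chi g ^+ n.
Proof.
move=> [chi1 chiM]; elim: n => [|n IH]; first by rewrite expg0 chi1.
by rewrite expgS exprS chiM ?inE // IH.
Qed.

Unset Implicit Arguments.
Set Strict Implicit.
Set Printing Implicit Defensive.

Theorem theorem3p4 (k : closedFieldType) (char0 : [pchar k] =i pred0)
    (gT : finGroupType) (abelG : abelian [set: gT])
    (g1 g2 : gT) (chi1 chi2 : gT -> k)
    (chi1_char : is_character [set: gT] chi1)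
    (chi2_char : is_character [set: gT] chi2)
    (chi12 : chi1 g2 * chi2 g1 = 1)
    (r s : nat) (r_gt1 : (1 < r)%N) (s_gt1 : (1 < s)%N)
    (r_ord : r.-primitive_root (chi1 g1))
    (s_ord : s.-primitive_root (chi2 g2))
    (alpha11 alpha22 nu : k)
    (alpha11P : (g1 ^+ r)%g = 1%g \/ ~ (forall h, chi1 h ^+ r = 1) ->
       alpha11 = 0)
    (alpha22P : (g2 ^+ s)%g = 1%g \/ ~ (forall h, chi2 h ^+ s = 1) ->
       alpha22 = 0)
    (nuP : (g1 * g2)%g = 1%g \/ ~ (forall h, chi1 h * chi2 h = 1) ->
       nu = 0)
    (xi : gT -> k) (xi_char : is_character (Lambda chi1 chi2) xi)
    (alpha1 : lifting_alpha g1 r alpha11 xi = 1)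
    (beta1 : lifting_beta g2 s alpha22 xi = 1)
    (nu0 : nu = 0) :
  semisimple_ring
    (lifting_quot g1 g2 chi1 chi2 r s alpha11 alpha22 nu xi).
Proof.
pose rel := lifting_quot_rel g1 g2 chi1 chi2 r s alpha11 alpha22 nu xi.
pose A := pres_alg rel.
pose x : A := pres_pi rel (gen_x k gT).
pose y : A := pres_pi rel (gen_y k gT).
pose e h : A := pres_pi rel (gen_grp k h).
have piR u v : lifting_rel g1 g2 chi1 chi2 r s alpha11 alpha22 nu u v ->
  pres_pi rel u = pres_pi rel v.
  by move=> uv; apply/pres_pi_rel/lifting_quot_lift.
have e1 : e 1%g = 1 by rewrite -(rmorph1 (pres_pi rel)); apply/piR/lifting_grp1.
have eM g h : e (g * h)%g = e g * e h.
  by rewrite -rmorphM; apply/esym/piR/lifting_grpM.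
have hx h : e h * x = chi1 h *: (x * e h).
  by rewrite -!rmorphM -[RHS]pres_pi_is_scalable; apply/piR/lifting_hx.
have hy h : e h * y = chi2 h *: (y * e h).
  by rewrite -!rmorphM -[RHS]pres_pi_is_scalable; apply/piR/lifting_hy.
have xy : x * y = chi2 g1 *: (y * x).
  rewrite -!rmorphM -[RHS]pres_pi_is_scalable.
  etransitivity; first exact/piR/lifting_xy.
  by rewrite nu0 scale0r addr0.
have eL g : g \in Lambda chi1 chi2 -> e g = xi g *: (1 : A).
  move=> gL; rewrite -[1 : A](rmorph1 (pres_pi rel)) -[RHS]pres_pi_is_scalable.
  exact/pres_pi_rel/lifting_quot_Lambda.
have xr : x ^+ r = 1.
  have a0 : alpha11 <> 0.
    move=> a0; move/eqP: alpha1.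
    by rewrite /lifting_alpha a0 mul0r eq_sym oner_eq0.
  have chi1r : forall h, chi1 h ^+ r = 1.
    by apply: contrapT => nchi; apply/a0/alpha11P; right.
  (* For [chi2], raise [chi12] to the power [r]: as [chi1 g2 ^+ r = 1], also [chi2 g1 ^+ r = 1]. The
     relation for [x ^+ r] then evaluates to [lifting_alpha], that is, to 1. *)
  have gL : (g1 ^+ r)%g \in Lambda chi1 chi2.
    rewrite inE !characterX // chi1r eqxx; apply/eqP.
    by rewrite -[LHS]mul1r -(chi1r g2) -exprMn chi12 expr1n.
  rewrite -rmorphXn; etransitivity; first exact/piR/lifting_xr.
  transitivity (alpha11 *: (e (g1 ^+ r)%g - 1)).
    rewrite pres_pi_is_scalable; congr (_ *: _).
    by rewrite [LHS](rmorphB (pres_pi rel)) (rmorph1 (pres_pi rel)).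
  rewrite (eL _ gL).
  rewrite -[X in _ - X]scale1r -scalerBl scalerA.
  by rewrite -[_ * _]/(lifting_alpha _ _ _ _) alpha1 scale1r.
have ys : y ^+ s = 1.
  have a0 : alpha22 <> 0.
    move=> a0; move/eqP: beta1.
    by rewrite /lifting_beta a0 mul0r eq_sym oner_eq0.
  have chi2s : forall h, chi2 h ^+ s = 1.
    by apply: contrapT => nchi; apply/a0/alpha22P; right.
  have gL : (g2 ^+ s)%g \in Lambda chi1 chi2.
    rewrite inE !characterX // chi2s eqxx andbT; apply/eqP.
    by rewrite -[LHS]mulr1 -(chi2s g1) -exprMn chi12 expr1n.
  rewrite -rmorphXn; etransitivity; first exact/piR/lifting_ys.
  transitivity (alpha22 *: (e (g2 ^+ s)%g - 1)).
    rewrite pres_pi_is_scalable; congr (_ *: _).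
    by rewrite [LHS](rmorphB (pres_pi rel)) (rmorph1 (pres_pi rel)).
  rewrite (eL _ gL).
  rewrite -[X in _ - X]scale1r -scalerBl scalerA.
  by rewrite -[_ * _]/(lifting_beta _ _ _ _) beta1 scale1r.
(* By [chi12], [chi1 g2] is the inverse of [chi2 g1]. *)
have yx : y * x = chi1 g2 *: (x * y) by rewrite xy scalerA chi12 scale1r.
have iE c a : c *: a = pres_const rel c * a := esym (pres_constE c a).
have hx' h : e h * x = pres_const rel (chi1 h) * (x * e h).
  exact: etrans (hx h) (iE _ _).
have hy' h : e h * y = pres_const rel (chi2 h) * (y * e h).
  exact: etrans (hy h) (iE _ _).
have yx' : y * x = pres_const rel (chi1 g2) * (x * y) := etrans yx (iE _ _).
have card_neq0 : #|{: 'Z_r * 'Z_s * gT}|%:R != 0 :> k.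
  have card_gt0 : (0 < #|{: 'Z_r * 'Z_s * gT}|)%N.
    by apply/card_gt0P; exists 1%g.
  (* Characteristic 0 makes the nonzero group order invertible in [k]. *)
  by have /pcharf0P-> := char0; rewrite -lt0n.
pose u := skew_monomial (r := r) (s := s) x y e.
have u1 : u 1%g = 1 := skew_monomial1 _ _ _ _ e1.
apply: (pres_projective_semisimple card_neq0 u1) => [p p'|].
  (* The scalar is read off from [skew_monomialM] with [q] equal to [chi1 g2]; it is a product of
     powers of character values, hence nonzero. *)
  eexists; last first.
    exact: (skew_monomialM (pres_constC (rel := rel)) r_gt1 s_gt1 xr ys eM
      hx' hy' yx').
  by rewrite !mulf_neq0 ?expf_neq0 ?character_neq0.
move=> [h|[]].
- by exists (0, 0, h); rewrite /u skew_monomial_grp.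
- by exists (0, 1, 1%g); rewrite /u skew_monomial_y.
- by exists (1, 0, 1%g); rewrite /u skew_monomial_x.
Qed.
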